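(* Let $q\geqslant 2$ be an integer and let $f$ be a real-valued $q$-additive function such that the series $\sum_{j\geqslant 0}\frac1q\sum_{d=0}^{q-1}|f(dq^j)|$ converges and $f(dq^j)\neq0$ for infinitely many pairs $(d,j)$. For $t>0$ let \[ S(t)=\{(d,j)\in\{1,\dots,q-1\}\times\mathbb{N} : |f(dq^j)|\leqslant \pi/|t|\}. \] Let $F$ be the limiting distribution function of $f$. Set $c_1=2/(\pi^2q^2)$, and for an integer $N\geqslant1$ and real $T\geqslant1$ set $L=\lfloor\log_qN\rfloor$ and $h=\lceil\log_q(T\log T)\rceil$. Then for all real $T\geqslant 1$ with $h\leqslant L$, \begin{align*} \|F_N-F\|_\infty &\ll \frac1T\int_0^T\exp\Big(-c_1t^2\sum_{(d,j)\in S(t)}f(dq^j)^2\Big)\,dt + T\sum_{j=L-h+1}^{L}\sum_{d=0}^{q-1}|f(dq^j)|\\ &\quad+\int_{1/T}^{T}\min\Big\{\frac1{1+t},\sum_{j>L}\sum_{d=0}^{q-1}|f(dq^j)|\Big\}\exp\Big(-c_1t^2\sum_{(d,j)\in S(t),\,j\leqslant L}f(dq^j)^2\Big)\,dt, \end{align*} where the implicit constant depends on $q$.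
   Context: A function $f:\mathbb{Z}_{\geqslant 0}\to\mathbb{R}$ is $q$-additive if $f(0)=0$ and $f(d_1q^{e_1}+\cdots+d_rq^{e_r})=f(d_1q^{e_1})+\cdots+f(d_rq^{e_r})$ whenever $0\leqslant e_1<\cdots<e_r$ are distinct integers and $d_i\in\{1,\dots,q-1\}$; in particular $f(0\cdot q^j)=0$. $F_N(y)=\frac1N\#\{n<N:f(n)\leqslant y\}$ is the distribution function of $(f(n):n<N)$, $F(y)=\lim_{N\to\infty}F_N(y)$ is the limiting distribution function, and $\|\cdot\|_\infty$ is the sup norm over $y\in\mathbb{R}$.
   Formalization: The implicit constant here depends on q and also on the value of the convergent series (1/q)∑_j∑_d |f(dq^j)|; with a constant depending on q alone the bound is false (a 2-additive f with values 0, 1 and 2^{-j}, T=3, N=2^{K+2} gives a counterexample). *)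

(* Defs.v *)
From HB Require Import structures.
From mathcomp Require Import all_boot all_order all_algebra.
From mathcomp Require Import all_classical all_reals all_analysis.
Set Implicit Arguments.
Unset Strict Implicit.
Unset Printing Implicit Defensive.
Import Order.TTheory GRing.Theory Num.Theory.
Import numFieldNormedType.Exports.
Local Open Scope classical_set_scope.
Local Open Scope ring_scope.

(* The case r = 0 of the second clause is f 0 = 0 again. *)
Definition q_additive (R : realType) (q : nat) (f : nat -> R) : Prop :=
  f 0%N = 0 /\
  forall (r : nat) (d e : 'I_r -> nat),
    (forall i, (0 < d i < q)%N) ->
    (forall i j : 'I_r, (i < j)%N -> (e i < e j)%N) ->
    f (\sum_(i < r) d i * q ^ e i)%N = \sum_(i < r) f (d i * q ^ e i)%N.

Definition digit_abs (R : realType) (q : nat) (f : nat -> R) (j : nat) : R :=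
  \sum_(d < q) `|f (d * q ^ j)%N|.

Definition digit_mean_abs (R : realType) (q : nat) (f : nat -> R) (j : nat) : R :=
  q%:R^-1 * digit_abs q f j.

Definition digit_pairs (q : nat) : set (nat * nat) :=
  [set p | (0 < p.1 < q)%N].

Definition empirical_df (R : realType) (f : nat -> R) (N : nat) (y : R) : R :=
  #|[pred n : 'I_N | f n <= y]|%:R / N%:R.

Definition limiting_df (R : realType) (f : nat -> R) (F : R -> R) : Prop :=
  forall y : R, empirical_df f N y @[N --> \oo] --> F y.

Definition sup_norm (R : realType) (g : R -> R) : \bar R :=
  ereal_sup (range (fun y => `|g y|%:E)).

(* Only t > 0 matters; at t = 0 the bound pi / `|t| is 0 by convention, which
   does not affect the integrals over t below. *)
Definition small_pairs (R : realType) (q : nat) (f : nat -> R) (t : R) :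
    set (nat * nat) :=
  digit_pairs q `&` [set p | `|f (p.1 * q ^ p.2)%N| <= pi / `|t|].

(* The sum is finite whenever the series of digit_mean_abs converges. *)
Definition sum_sq (R : realType) (q : nat) (f : nat -> R) (A : set (nat * nat)) : R :=
  fine (\esum_(p in A) (f (p.1 * q ^ p.2)%N ^+ 2)%:E)%E.

Definition c1 (R : realType) (q : nat) : R := 2 / (pi ^+ 2 * q%:R ^+ 2).

(* Ceiling of log_q (T log T). At T = 1 the logarithm of 0 is 0 in the library,
   so height = 0 and, as for any height <= 0 (such as -oo), window_sum is empty. *)
Definition height (R : realType) (q : nat) (T : R) : int :=
  Num.ceil (ln (T * ln T) / ln q%:R).

(* The sum over L - h + 1 <= j <= L; the bounds are compared in int as h may be
   negative. *)
Definition window_sum (R : realType) (q : nat) (f : nat -> R) (L : nat) (h : int) : R :=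
  \sum_(j < L.+1 | (L%:Z - h + 1 <= j%:Z)%R) digit_abs q f j.

Definition tail_sum (R : realType) (q : nat) (f : nat -> R) (L : nat) : R :=
  fine (\sum_(L.+1 <= j <oo) (digit_abs q f j)%:E)%E.

Definition first_term (R : realType) (q : nat) (f : nat -> R) (T : R) : R :=
  T^-1 * \int[lebesgue_measure]_(t in `[0, T])
    expR (- c1 R q * t ^+ 2 * sum_sq q f (small_pairs q f t)).

Definition second_term (R : realType) (q : nat) (f : nat -> R) (L : nat) (T : R) : R :=
  T * window_sum q f L (height q T).

Definition third_term (R : realType) (q : nat) (f : nat -> R) (L : nat) (T : R) : R :=
  \int[lebesgue_measure]_(t in `[T^-1, T])
    (Num.min (1 + t)^-1 (tail_sum q f L) *
     expR (- c1 R q * t ^+ 2 *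
           sum_sq q f (small_pairs q f t `&` [set p | (p.2 <= L)%N]))).

(* An inequality F_N - F << error_bound cannot hold with a constant depending on
   q alone. For q = 2 and K large let f be the 2-additive function with
   f (2 ^ j) = 1 for j < K and for K + 2 < j <= 2 * K + 2, f (2 ^ j) = 0 for
   K <= j <= K + 2, and f (2 ^ j) = 2 ^ (- j) beyond; take T = 3 and
   N = 2 ^ (K + 2), so that L = K + 2 and h = 2. Then F_N is Bin(K, 1/2), F is
   Bin(2 K, 1/2) up to a negligible shift, and their distance tends to 1, whereas
   second_term = 0, first_term = O(K ^ (-1/2)) and third_term = O(exp (- c K)).
   The constant must thus also be allowed to depend on f; dependence through the
   sum of the series of digit_mean_abs is enough. *)
Definition error_bound (R : realType) (q : nat) (f : nat -> R) (L : nat) (T : R) : R :=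
  first_term q f T + second_term q f L T + third_term q f L T.

(* Main.v *)
Require Import Defs.
From HB Require Import structures.
From mathcomp Require Import all_boot all_order all_algebra.
From mathcomp Require Import all_classical all_reals all_analysis.
From mathcomp Require Import ring lra zify.
Import Order.TTheory GRing.Theory Num.Theory.
Import numFieldNormedType.Exports.
Local Open Scope classical_set_scope.
Local Open Scope ring_scope.
Set Implicit Arguments.
Unset Strict Implicit.
Unset Printing Implicit Defensive.

(** Restricting n < q^m to its first digits changes f(n) by at most a partial sum
of the digit series, and changes frequencies by at most q^m / N.  Hence F_N - F is
bounded by the probability that the sum of finitely many independent digits falls
in a short interval, plus O(1/T): the interval has length O(1/T) if the tail is at
most 1/T, and length O(tail) otherwise, in which case only the digits up to L are
used.  Esseen's concentration inequality, obtained by averaging the Fejer kernel,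
bounds this probability by an integral of the characteristic function, which is a
product over the digits.  No smoothing inequality for the difference of two
characteristic functions is needed, since the tail is a bounded variable: on
[0, 1/tail] the minimum in the third term is comparable to the tail.  Terms O(1/T)
are absorbed by the first term, which is at least a constant over T because
t^2 f^2 <= pi t |f| on S(t). *)

(** * Trigonometric bounds for the exponential sum over one digit *)

Section trigonometry.
Context {R : realType}.
Implicit Types x y u v a b t : R.

(** Concavity through the mean value theorem: the chord slopes on [0, y] and [y, pi/2] are values of
    cos, which decreases, so the first one exceeds the overall slope 2/pi. *)
Lemma jordan_sin y : 0 <= y <= pi / 2 -> 2 / pi * y <= sin y.
Proof.
move=> /andP[y0 ypi].
have pi0 : 0 < pi :> R := pi_gt0 R.
have [->|yN0] := eqVneq y 0; first by rewrite mulr0 sin0.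
have [->|yNpi] := eqVneq y (pi / 2).
  by rewrite sin_pihalf mulrA divfK ?gt_eqF// divff.
have {}y0 : 0 < y by rewrite lt_neqAle eq_sym yN0.
have {}ypi : y < pi / 2 by rewrite lt_neqAle yNpi.
have dsin x : x \in `]0, y[%R \/ x \in `]y, (pi / 2)[%R -> is_derive x 1 sin (cos x).
  by move=> _; exact: is_derive_sin.
have csin (A : set R) : {within A, continuous (@sin R)}.
  by apply: continuous_subspaceT => x; exact: continuous_sin.
have [c1 + e1] := MVT y0 (fun x h => dsin x (or_introl h)) (csin _).
have [c2 + e2] := MVT ypi (fun x h => dsin x (or_intror h)) (csin _).
rewrite !in_itv/= => /andP[yc2 c2pi] /andP[c10 c1y].
have c12 : cos c2 < cos c1.
  have c1pi : c1 \in `[0, pi]%R by rewrite in_itv/=; apply/andP; split; lra.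
  have c2pi' : c2 \in `[0, pi]%R by rewrite in_itv/=; apply/andP; split; lra.
  by rewrite ltr_cos//; exact: lt_trans yc2.
rewrite sin0 !subr0 in e1; rewrite sin_pihalf in e2.
rewrite e1 ler_pM2r// ler_pdivrMr//; nra.
Qed.

(** Half-angle formula, then [jordan_sin] at |x|/2. *)
Lemma cos_le_quadratic x : `|x| <= pi -> cos x <= 1 - 2 * x ^+ 2 / pi ^+ 2.
Proof.
move=> xpi; have pi0 : 0 < pi :> R := pi_gt0 R.
have /jordan_sin s : 0 <= `|x| / 2 <= pi / 2 by rewrite divr_ge0//= ler_wpM2r.
have -> : cos x = 1 - 2 * sin (`|x| / 2) ^+ 2.
  have {1}-> : x = (x / 2) *+ 2 by rewrite -mulr_natr; field.
  rewrite cos_mulr2n cos2sin2 (_ : sin (x / 2) ^+ 2 = sin (`|x| / 2) ^+ 2); first ring.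
  have [x0|x0] := lerP 0 x; first by rewrite ger0_norm.
  by rewrite ltr0_norm// mulNr sinN sqrrN.
rewrite lerD2l lerN2 -mulrA ler_pM2l//.
have -> : x ^+ 2 / pi ^+ 2 = (2 / pi * (`|x| / 2)) ^+ 2.
  rewrite -(real_normK (num_real x)); move: (gt_eqF pi0).
  by move: (pi : R) => p p0; field; rewrite p0.
by rewrite ler_pXn2r// nnegrE ?(le_trans _ s)// mulr_ge0// divr_ge0// ltW.
Qed.

Lemma cauchy_schwarz2 u v a b : u ^+ 2 + v ^+ 2 = 1 ->
  (u * a + v * b) ^+ 2 <= a ^+ 2 + b ^+ 2.
Proof.
move=> uv1; rewrite -[leRHS]mul1r -uv1 -subr_ge0.
rewrite (_ : _ - _ = (u * b - v * a) ^+ 2) ?sqr_ge0//; ring.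
Qed.

(** The triangle inequality for unit vectors of the plane: adding (u, v) to a sum (A, B) of n of
    them raises the squared length by 1 + 2(uA + vB), and uA + vB is at most n by Cauchy-Schwarz. *)
Lemma sqr_norm_sum (I : Type) (s : seq I) (a b : I -> R) :
  (forall i, a i ^+ 2 + b i ^+ 2 = 1) ->
  (\sum_(i <- s) a i) ^+ 2 + (\sum_(i <- s) b i) ^+ 2 <= (size s)%:R ^+ 2.
Proof.
move=> ab1; elim: s => [|i s IHs]; first by rewrite !big_nil /= expr0n/= addr0.
rewrite !big_cons /= -natr1.
move: IHs (ab1 i) (ler0n R (size s)).
move: (\sum_(_ <- _) _) (\sum_(_ <- _) _) (a i) (b i) (size s)%:R => B A u v n le_n uv1 n0.
suff : u * A + v * B <= n by nra.
apply: le_trans (ler_norm _) _.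
rewrite -ler_sqr ?nnegrE// real_normK ?num_real//.
by apply: le_trans le_n; rewrite cauchy_schwarz2.
Qed.

(* The left-hand side is [sum_(i, j) cos (z i - z j)]; only the pairs containing
   the index 0 are used to improve on the trivial bound. *)
Lemma sqr_norm_sum_unit q (z : nat -> R) : z 0%N = 0 ->
  (\sum_(d < q.+1) cos (z d)) ^+ 2 + (\sum_(d < q.+1) sin (z d)) ^+ 2 <=
  q.+1%:R ^+ 2 - 2 * \sum_(d < q.+1) (1 - cos (z d)).
Proof.
move=> z0; rewrite !big_ord_recl/= z0 cos0 sin0 subrr.
have := @sqr_norm_sum _ (index_enum 'I_q) 
  (fun i => cos (z (bump 0 i))) (fun i => sin (z (bump 0 i))) (fun i => cos2Dsin2 _).
have -> : size (index_enum 'I_q) = q by rewrite /index_enum -enumT size_enum_ord.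
rewrite sumrB sumr_const card_ord -natr1.
move: (\sum_(_ <- _) cos _) (\sum_(_ <- _) sin _) => A B. nra.
Qed.

(** The share of position j in the sum over S(t). The condition avoids division by t, so that it is
    also meaningful at t = 0. *)
Definition small_sq q (f : nat -> R) t (j : nat) : R :=
  \sum_(d < q | `|t * f (d * q ^ j)%N| <= pi) f (d * q ^ j)%N ^+ 2.

(** Origin of [c1]: with s the sum of small squares, the quadratic bound for cos turns the loss in
    [sqr_norm_sum_unit] into q^2 (1 - 2 c1 t^2 s), and 1 - x <= exp(-x) makes this the square of q
    exp(-c1 t^2 s). *)
Lemma digit_factor_le q (f : nat -> R) t j : (0 < q)%N -> f 0%N = 0 ->
  (\sum_(d < q) cos (t * f (d * q ^ j)%N)) ^+ 2 +
  (\sum_(d < q) sin (t * f (d * q ^ j)%N)) ^+ 2 <=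
  (q%:R * expR (- c1 R q * t ^+ 2 * small_sq q f t j)) ^+ 2.
Proof.
case: q => // q _ f0.
apply: le_trans (@sqr_norm_sum_unit q (fun d => t * f (d * q.+1 ^ j)%N) _) _.
  by rewrite mul0n f0 mulr0.
set s := \sum_(_ < _) _.
have q0 : 0 < q.+1%:R :> R by rewrite ltr0n.
have pi0 : 0 < pi :> R := pi_gt0 R.
have sle : 2 / pi ^+ 2 * t ^+ 2 * small_sq q.+1 f t j <= s.
  rewrite /small_sq mulr_sumr big_mkcond ler_sum// => d _.
  case: ifPn => [/cos_le_quadratic h|_]; last by rewrite subr_ge0 cos_le1.
  rewrite exprMn in h; rewrite -mulrA; lra.
apply: (@le_trans _ _ (q.+1%:R ^+ 2 *
    (1 - 2 / q.+1%:R ^+ 2 * (2 / pi ^+ 2 * t ^+ 2 * small_sq q.+1 f t j)))).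
  rewrite [leRHS](_ : _ = q.+1%:R ^+ 2 - 2 * (2 / pi ^+ 2 * t ^+ 2 * small_sq q.+1 f t j)).
    by rewrite lerD2l lerN2 ler_pM2l.
  move: (_ * small_sq _ _ _ _) q.+1%:R (gt_eqF q0) => X r r0.
  by field; rewrite r0.
rewrite exprMn ler_pM2l ?exprn_gt0// -expRM_natl.
apply: le_trans (expR_ge1Dx _) _.
rewrite ler_expR le_eqVlt; apply/orP; left; apply/eqP.
rewrite /c1; move: (gt_eqF pi0) (gt_eqF q0).
by move: (pi : R) q.+1%:R => p r p0 r0; field; rewrite p0 r0.
Qed.
End trigonometry.

(** * Digit expansions and exponential sums of a q-additive function *)

Section q_additive.
Context {R : realType} (q : nat) (f : nat -> R).
Context (q2 : (2 <= q)%N).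
Context (fq : q_additive q f).

Let q0 : (0 < q)%N. Proof. exact: leq_trans q2. Qed.

(** The data quantified over in [q_additive], with all positions below m so that a digit at position
    m can be appended. *)
Definition digit_expansion (m a r : nat) (d e : 'I_r -> nat) : Prop :=
  [/\ forall i, (0 < d i < q)%N,
      forall i j : 'I_r, (i < j)%N -> (e i < e j)%N,
      forall i, (e i < m)%N & a = (\sum_(i < r) d i * q ^ e i)%N].

(** [ord_max] is the only index on which [unlift ord_max] fails, so [ext] appends a last value to a
    family. *)
Lemma digit_expansion_rcons m a r (d e : 'I_r -> nat) c :
  digit_expansion m a d e -> (0 < c < q)%N ->
  let ext (g : 'I_r -> nat) x (i : 'I_r.+1) := 
    if unlift ord_max i is Some j then g j else x in
  digit_expansion m.+1 (a + c * q ^ m) (ext d c) (ext e m).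
Proof.
move=> [dq emono em ->] cq ext.
have extw g x (i : 'I_r) : ext g x (widen_ord (leqnSn r) i) = g i.
  rewrite /ext (_ : widen_ord _ i = lift ord_max i) ?liftK//.
  by apply: val_inj; rewrite /= /bump leqNgt ltn_ord.
have extm g x : ext g x ord_max = x by rewrite /ext unlift_none.
split.
- by move=> i; rewrite /ext; case: unlift.
- move=> i j; rewrite /ext; case: unliftP => [i'|] ->; case: unliftP => [j'|] ->; rewrite /= ?/bump.
  + by rewrite !(leqNgt r) !ltn_ord; exact: emono.
  + by move=> _; exact: em.
  + by rewrite (leqNgt r) ltn_ord/= add0n ltnNge (ltnW (ltn_ord j')).
  + by rewrite ltnn.
- by move=> i; rewrite /ext; case: unlift => // j; rewrite ltnS ltnW.
- rewrite big_ord_recr/= !extm; congr (_ + _)%N.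
  by apply: eq_bigr => i _; rewrite !extw.
Qed.

Lemma digit_expansionW m a r (d e : 'I_r -> nat) :
  digit_expansion m a d e -> digit_expansion m.+1 a d e.
Proof. by move=> [dq emono em ->]; split=> // i; rewrite ltnS ltnW. Qed.

(** Euclidean division by q^m peels off the leading digit; a zero quotient appends nothing, because
    the digits of an expansion are positive. *)
Lemma digit_expansion_exists m a : (a < q ^ m)%N ->
  exists r (d e : 'I_r -> nat), digit_expansion m a d e.
Proof.
elim: m a => [|m IHm] a am.
  exists 0%N, (fun=> 0%N), (fun=> 0%N); split; try by case.
  by rewrite big_ord0; case: a am.
have qm0 : (0 < q ^ m)%N by rewrite expn_gt0 q0.
have [r [d [e dex]]] := IHm (a %% q ^ m)%N (ltn_pmod a qm0).
rewrite (divn_eq a (q ^ m)) addnC.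
have [->|aq] := posnP (a %/ q ^ m)%N.
  by exists r, d, e; rewrite addn0; exact: digit_expansionW.
eexists _, _, _; apply: (digit_expansion_rcons dex).
by rewrite aq /= ltn_divLR// -expnS.
Qed.

(** The form in which additivity is used: one leading digit at a time. Both f(a) and the left-hand
    side are expanded along the same digits of a. *)
Lemma q_additiveD m a c : (a < q ^ m)%N -> (c < q)%N ->
  f (a + c * q ^ m)%N = f a + f (c * q ^ m)%N.
Proof.
move=> am cq; have [f0 fD] := fq.
have [->|c0] := posnP c; first by rewrite mul0n f0 addn0 addr0.
have [r [d [e dex]]] := digit_expansion_exists am.
have [|dq emono _ ->] := digit_expansion_rcons dex (c := c).
  by rewrite c0.
rewrite fD// big_ord_recr/= !unlift_none; congr (_ + _).
have [dq' emono' _ {1}->] := dex; rewrite fD//; apply: eq_bigr => i _.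
have -> : widen_ord (leqnSn r) i = lift ord_max i.
  by apply: val_inj; rewrite /= /bump leqNgt ltn_ord.
by rewrite liftK.
Qed.

Lemma sum_expnS (G : nat -> R) m :
  \sum_(n < q ^ m.+1) G n = \sum_(d < q) \sum_(a < q ^ m) G (a + d * q ^ m)%N.
Proof.
rewrite -(big_mkord xpredT) expnS big_nat_mul big_mkord; apply: eq_bigr => d _.
by rewrite -{1}[(d * _)%N]add0n big_addn mulSn addnK big_mkord.
Qed.

(* The squared modulus of a sum of [exp (i t f n)] is multiplicative over
   digits; it is kept in real form as a sum of two squares. *)
Lemma sqr_sum_expn t m :
  (\sum_(n < q ^ m) cos (t * f n)) ^+ 2 + (\sum_(n < q ^ m) sin (t * f n)) ^+ 2 =
  \prod_(j < m) ((\sum_(d < q) cos (t * f (d * q ^ j)%N)) ^+ 2 +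
                 (\sum_(d < q) sin (t * f (d * q ^ j)%N)) ^+ 2).
Proof.
elim: m => [|m IHm].
  by rewrite big_ord0 expn0 !big_ord_recl !big_ord0 !addr0 cos2Dsin2.
rewrite big_ord_recr/= -IHm (sum_expnS (fun n => cos (t * f n)))
  (sum_expnS (fun n => sin (t * f n))).
set A := \sum_(_ < _) cos _; set B := \sum_(_ < _) sin _.
(* Complex multiplication in real form: by the addition formulas the sum over q^(m+1) is (A + iB)(C
   + iS), with C and S the sums over the leading digit. The final [ring] checks that squared moduli
   multiply. *)
have -> : \sum_(d < q) \sum_(a < q ^ m) cos (t * f (a + d * q ^ m)%N) =
    A * \sum_(d < q) cos (t * f (d * q ^ m)%N) - B * \sum_(d < q) sin (t * f (d * q ^ m)%N).
  rewrite !mulr_sumr -sumrB; apply: eq_bigr => d _.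
  rewrite !mulr_suml -sumrB; apply: eq_bigr => a _.
  by rewrite q_additiveD// mulrDr cosD.
have -> : \sum_(d < q) \sum_(a < q ^ m) sin (t * f (a + d * q ^ m)%N) =
    B * \sum_(d < q) cos (t * f (d * q ^ m)%N) + A * \sum_(d < q) sin (t * f (d * q ^ m)%N).
  rewrite !mulr_sumr -big_split; apply: eq_bigr => d _.
  rewrite !mulr_suml -big_split; apply: eq_bigr => a _.
  by rewrite q_additiveD// mulrDr sinD.
move: A B (\sum_(d < q) cos _) (\sum_(d < q) sin _) => A B C S; ring.
Qed.

Definition small_sq_upto m t : R := \sum_(j < m) small_sq q f t j.

(** The left-hand side is the real part of exp(-ity) times the exponential sum, so Cauchy-Schwarz
    bounds it by the modulus, uniformly in y. *)
Lemma sum_cos_le t y m :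
  \sum_(n < q ^ m) cos (t * (f n - y)) <=
  (q ^ m)%:R * expR (- c1 R q * t ^+ 2 * small_sq_upto m t).
Proof.
set E := _ * expR _.
have E0 : 0 <= E by rewrite mulr_ge0 ?expR_ge0.
have -> : \sum_(n < q ^ m) cos (t * (f n - y)) =
    cos (t * y) * \sum_(n < q ^ m) cos (t * f n) + sin (t * y) * \sum_(n < q ^ m) sin (t * f n).
  rewrite !mulr_sumr -big_split; apply: eq_bigr => n _.
  by rewrite mulrBr cosB /= mulrC (mulrC (sin _)).
have sqE : (\sum_(n < q ^ m) cos (t * f n)) ^+ 2 + (\sum_(n < q ^ m) sin (t * f n)) ^+ 2 <= E ^+ 2.
  rewrite sqr_sum_expn.
  have -> : E ^+ 2 = \prod_(j < m) (q%:R * expR (- c1 R q * t ^+ 2 * small_sq q f t j)) ^+ 2.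
    rewrite prodrXl big_split/= prodr_const card_ord -natrX -expR_sum /E.
    by rewrite /small_sq_upto mulr_sumr.
  apply: ler_prod => j _; rewrite addr_ge0 ?sqr_ge0//=.
  exact: digit_factor_le q0 fq.1.
apply: le_trans (ler_norm _) _.
rewrite -ler_sqr ?nnegrE// real_normK ?num_real//.
by apply: le_trans sqE; exact: cauchy_schwarz2 (cos2Dsin2 _).
Qed.
End q_additive.

(** * Integrals of bounded functions and the Fejer kernel *)

Section integration.
Context {R : realType}.
Implicit Types (D : set R) (g h : R -> R).
Local Notation mu := (@lebesgue_measure R).

(* The integrands of the theorem are never shown to be measurable: the integral
   of an arbitrary function, as a difference of suprema over simple functions, is
   monotone anyway. *)
Lemma le_integral_restrict D1 D2 (g h : R -> \bar R) :
  (forall t, (g \_ D1) t <= (h \_ D2) t)%E ->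
  (\int[mu]_(t in D1) g t <= \int[mu]_(t in D2) h t)%E.
Proof.
move=> gh; rewrite /integral; apply: leeB; apply: ereal_sup_le => _ [s /= sle <-].
  exists s => // x; apply: le_trans (sle x) _.
  by rewrite !funeposE ge_max !le_max gh lexx orbT.
exists s => // x; apply: le_trans (sle x) _.
by rewrite !funenegE ge_max !le_max leeN2 gh lexx orbT.
Qed.

Lemma bounded_integral_fin_num a b D g B : a <= b -> D `<=` `[a, b]%classic ->
  (forall t, D t -> `|g t| <= B) -> (\int[mu]_(t in D) (g t)%:E)%E \is a fin_num.
Proof.
(* The extension of g by 0 outside D must lie between the bounds too, and B may be negative when D
   is empty. *)
move=> ab Dab gB; pose B' := Num.max B 0.
have B'0 : 0 <= B' by rewrite le_max lexx orbT.
have mab : measurable `[a, b]%classic := measurable_itv _.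
have bnd r : (\int[mu]_(t in `[a, b]) r%:E)%E \is a fin_num.
  by rewrite integral_cst//= lebesgue_measure_itv/=; case: ifP.
have lo : (\int[mu]_(t in `[a, b]) (- B')%:E <= \int[mu]_(t in D) (g t)%:E)%E.
  apply: le_integral_restrict => t; rewrite /patch.
  case: ifPn => tab; case: ifPn => tD; rewrite ?lee_fin ?oppr_le0//.
    have := gB t (set_mem tD); rewrite ler_norml => /andP[+ _]; apply: le_trans.
    by rewrite lerN2 le_max lexx.
  by move: tab; rewrite notin_setE => /(_ (Dab _ (set_mem tD))).
have up : (\int[mu]_(t in D) (g t)%:E <= \int[mu]_(t in `[a, b]) (B')%:E)%E.
  apply: le_integral_restrict => t; rewrite /patch.
  case: ifPn => tD; case: ifPn => tab; rewrite ?lee_fin//.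
    have := gB t (set_mem tD); rewrite ler_norml => /andP[_ /le_trans]; apply.
    by rewrite le_max lexx.
  by move: tab; rewrite notin_setE => /(_ (Dab _ (set_mem tD))).
rewrite fin_numE; apply/andP; split; apply/eqP => E.
  by have := bnd (- B'); move: lo; rewrite E leeNy_eq => /eqP ->.
by have := bnd B'; move: up; rewrite E leye_eq => /eqP ->.
Qed.

(** The bounds provide finiteness: [fine] sends infinite values to 0 and is monotone on finite ones.
    Comparing extensions by zero allows two different domains. *)
Lemma le_Rintegral_restrict a b D1 D2 g h B : a <= b ->
  D1 `<=` `[a, b]%classic -> D2 `<=` `[a, b]%classic ->
  (forall t, D1 t -> `|g t| <= B) -> (forall t, D2 t -> `|h t| <= B) ->
  (forall t, (g \_ D1) t <= (h \_ D2) t) ->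
  \int[mu]_(t in D1) g t <= \int[mu]_(t in D2) h t.
Proof.
move=> ab D1ab D2ab gB hB gh; apply: fine_le.
- exact: bounded_integral_fin_num ab D1ab gB.
- exact: bounded_integral_fin_num ab D2ab hB.
apply: le_integral_restrict => t; move: (gh t); rewrite /patch.
by case: ifP; case: ifP.
Qed.

Lemma le_Rintegral_bounded a b g h B : a <= b ->
  (forall t, a <= t <= b -> [/\ `|g t| <= B, `|h t| <= B & g t <= h t]) ->
  \int[mu]_(t in `[a, b]) g t <= \int[mu]_(t in `[a, b]) h t.
Proof.
move=> ab gh; apply: (@le_Rintegral_restrict a b _ _ _ _ B) => //.
- by move=> t /=; rewrite in_itv/= => /gh[].
- by move=> t /=; rewrite in_itv/= => /gh[].
- move=> t; rewrite /patch; case: ifPn => //; rewrite inE/= in_itv/=.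
  by move=> /gh[].
Qed.

(** Triangle weight times a cosine; for x nonzero its integral over [0, U] is the nonnegative Fejer
    kernel (1 - cos (U x)) / (U x^2). *)
Definition fejer_kernel U x t : R := (1 - t / U) * cos (t * x).

Lemma fejer_kernel_continuous U x : continuous (fejer_kernel U x).
Proof.
move=> t; rewrite /fejer_kernel; apply: cvgM.
  by apply: cvgB; [exact: cvg_cst | apply: cvgMl; exact: cvg_id].
apply: (@cvg_comp _ _ _ (fun t : R => t * x) cos _ (nbhs (t * x))).
  by apply: cvgMl; exact: cvg_id.
exact: continuous_cos.
Qed.

Definition fejer_primitive U x t : R :=
  (1 - t * U^-1) * (x^-1 * sin (t * x)) - (U * x ^+ 2)^-1 * cos (t * x).

Lemma is_derive_fejer_primitive U x (t : R) : U != 0 -> x != 0 ->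
  is_derive t 1 (fejer_primitive U x) (fejer_kernel U x t).
Proof.
move=> U0 x0.
have dx : is_derive t (1 : R) (fun t : R => t * x) x.
  by apply: is_derive_eq; rewrite /GRing.scale/=; ring.
have ds : is_derive t (1 : R) (fun t : R => sin (t * x)) (cos (t * x) * x).
  exact: (is_derive1_comp (f := sin)).
have dc : is_derive t (1 : R) (fun t : R => cos (t * x)) (- sin (t * x) * x).
  exact: (is_derive1_comp (f := cos)).
rewrite /fejer_primitive; apply: is_derive_eq.
by rewrite /fejer_kernel /GRing.scale/=; field; rewrite U0 x0.
Qed.

Lemma Rintegral_primitive (a b : R) (g G : R -> R) : a < b -> continuous g ->
  (forall t : R, is_derive t 1 G (g t)) ->
  \int[mu]_(t in `[a, b]) g t = G b - G a.
Proof.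
move=> ab cg dG.
have cG : continuous G.
  by move=> t; apply/differentiable_continuous/derivable1_diffP; have [] := dG t.
rewrite /Rintegral (@continuous_FTC2 R g G a b)//.
- by apply: continuous_subspaceT.
- split; first by move=> t _; have [] := dG t.
  + exact/cvg_at_right_filter/cG.
  + exact/cvg_at_left_filter/cG.
- by move=> t _; rewrite derive1E; have [_ ->] := dG t.
Qed.

Lemma integrable_continuous (a b : R) (g : R -> R) : continuous g ->
  mu.-integrable `[a, b] (EFin \o g).
Proof.
move=> cg; apply: continuous_compact_integrable; first exact: segment_compact.
exact: continuous_subspaceT.
Qed.

(** For x nonzero the explicit value of the integral is nonnegative since cos <= 1, and
    [cos_le_quadratic] bounds it below when |U x| <= pi. *)
Lemma Rintegral_fejer_kernel U x : 0 < U ->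
  0 <= \int[mu]_(t in `[0, U]) fejer_kernel U x t /\
  (`|U * x| <= pi ->
    2 / pi ^+ 2 * U <= \int[mu]_(t in `[0, U]) fejer_kernel U x t).
Proof.
move=> U0; have UN0 : U != 0 by rewrite gt_eqF.
have pi0 : 0 < pi :> R := pi_gt0 R.
(* At x = 0 [fejer_primitive] would divide by zero, so a polynomial primitive is used; the integral
   is U/2, and pi >= 2 suffices. *)
have [->|x0] := eqVneq x 0.
  have -> : \int[mu]_(t in `[0, U]) fejer_kernel U 0 t = U / 2.
    have dG (t : R) : is_derive t 1 (fun t : R => t - (U * 2)^-1 * t ^+ 2) (fejer_kernel U 0 t).
      apply: is_derive_eq; rewrite /fejer_kernel mulr0 cos0 /GRing.scale/=.
      by field.
    rewrite (Rintegral_primitive U0 (@fejer_kernel_continuous _ _) dG).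
    by field.
  split=> [|_]; first by rewrite divr_ge0// ltW.
  rewrite mulrC ler_pM2l// ler_pdivrMr ?exprn_gt0//.
  have := pi_ge2 R; move: pi0; move: (pi : R) => p p0 p2; nra.
have x20 : 0 < x ^+ 2 by rewrite exprn_even_gt0.
have -> : \int[mu]_(t in `[0, U]) fejer_kernel U x t = (1 - cos (U * x)) / (U * x ^+ 2).
  have dG t := is_derive_fejer_primitive t UN0 x0.
  rewrite (Rintegral_primitive U0 (@fejer_kernel_continuous _ _) dG).
  by rewrite /fejer_primitive !mul0r sin0 cos0; field; rewrite UN0 x0.
split=> [|/cos_le_quadratic h]; first by rewrite divr_ge0 ?subr_ge0 ?cos_le1// ltW// mulr_gt0.
rewrite ler_pdivlMr ?(mulr_gt0 U0)//.
rewrite (_ : 2 / _ * _ * _ = 2 * (U * x) ^+ 2 / pi ^+ 2); first lra.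
by rewrite exprMn; move: (pi ^+ 2)^-1 => p; ring.
Qed.

Lemma Rintegral_sum_fejer_kernel (I : Type) (s : seq I) (x : I -> R) U : 0 < U ->
  continuous (fun t => \sum_(i <- s) fejer_kernel U (x i) t) /\
  2 / pi ^+ 2 * U * (count (fun i => `|U * x i| <= pi) s)%:R <=
  \int[mu]_(t in `[0, U]) \sum_(i <- s) fejer_kernel U (x i) t.
Proof.
move=> U0; elim: s => [|i s [IHc IHs]].
  split; first by under eq_fun do rewrite big_nil; exact: cst_continuous.
  by rewrite /= mulr0 Rintegral_ge0// => t _; rewrite big_nil.
have [ge0 gepi] := Rintegral_fejer_kernel (x i) U0.
have E t : \sum_(j <- i :: s) fejer_kernel U (x j) t =
    fejer_kernel U (x i) t + \sum_(j <- s) fejer_kernel U (x j) t by rewrite big_cons.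
split.
  under eq_fun do rewrite E; move=> t; apply: cvgD; last exact: IHc.
  exact: fejer_kernel_continuous.
have -> : \int[mu]_(t in `[0, U]) \sum_(j <- i :: s) fejer_kernel U (x j) t =
    \int[mu]_(t in `[0, U]) fejer_kernel U (x i) t +
    \int[mu]_(t in `[0, U]) \sum_(j <- s) fejer_kernel U (x j) t.
  under eq_Rintegral do rewrite E.
  apply: RintegralD; first exact: measurable_itv.
  - exact: integrable_continuous (@fejer_kernel_continuous _ _).
  - exact: integrable_continuous.
rewrite /= natrD mulrDr lerD//.
by case: (boolP (`|U * x i| <= pi)) => [/gepi|_]; rewrite ?mulr1 ?mulr0.
Qed.
End integration.

(** * Frequencies, reduction modulo Q and comparison of distribution functions *)

Section frequency.
Context {R : realType}.
Implicit Types (P : pred nat) (N Q : nat).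

(** Counting over [iota] makes splitting by concatenation and shifting by a period available. *)
Definition frequency P N : R := (count P (iota 0 N))%:R / N%:R.

Lemma empirical_dfE (f : nat -> R) N y :
  empirical_df f N y = frequency (fun n => f n <= y) N.
Proof.
rewrite /empirical_df /frequency -sum1_card -sum1_count; congr (_%:R / _).
by rewrite -[X in iota 0 X](subn0 N) -/(index_iota 0 N) big_mkord; apply: eq_bigl.
Qed.

Lemma frequency_sub P P' N : (forall n, (n < N)%N -> P n -> P' n) ->
  frequency P N <= frequency P' N.
Proof.
move=> PP'; rewrite ler_wpM2r ?invr_ge0// ler_nat.
elim: N PP' => // N IHN PP'.
rewrite -addn1 iotaD !count_cat /= leq_add//.
  by apply: IHN => n nN; apply: PP'; exact: ltnW.
by rewrite !addn0; case: (P _) (PP' N (ltnSn N)) => // ->.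
Qed.

Lemma count_modn P Q k r : (r <= Q)%N ->
  count (fun n => P (n %% Q)%N) (iota 0 (k * Q + r)) =
  (k * count P (iota 0 Q) + count (fun n => P (n %% Q)%N) (iota 0 r))%N.
Proof.
move=> rQ; have modQ : count (fun n => P (n %% Q)%N) (iota 0 Q) = count P (iota 0 Q).
  by apply: eq_in_count => n; rewrite mem_iota/= => nQ; rewrite modn_small.
elim: k => // k IHk; rewrite !mulSn -addnA iotaD count_cat modQ -addnA; congr addn.
rewrite add0n -[X in iota X]addn0 iotaDl count_map -IHk.
by apply: eq_count => n /=; rewrite modnDl.
Qed.

(** With N = kQ + r the difference is (c Q - c' r) / (N Q), where c and c' are the counts over [0,
    r) and [0, Q); both products lie between 0 and Q^2. *)
Lemma frequency_modn P Q N : (0 < Q)%N -> (0 < N)%N ->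
  `|frequency (fun n => P (n %% Q)%N) N - frequency P Q| <= Q%:R / N%:R.
Proof.
move=> Q0 N0; have rQ := ltnW (ltn_pmod N Q0).
have count_le P' M : (count P' (iota 0 M))%:R <= M%:R :> R.
  by rewrite ler_nat -{2}(size_iota 0 M) count_size.
have := count_le P Q; have := count_le (fun n => P (n %% Q)%N) (N %% Q)%N.
have N0' : 0 < N%:R :> R by rewrite ltr0n.
have Q0' : 0 < Q%:R :> R by rewrite ltr0n.
have rQ' : (N %% Q)%:R <= Q%:R :> R by rewrite ler_nat.
have EN : N%:R = (N %/ Q)%:R * Q%:R + (N %% Q)%:R :> R by rewrite -natrM -natrD -divn_eq.
have c0 := ler0n R (count (fun n => P (n %% Q)%N) (iota 0 (N %% Q))).
have C0 := ler0n R (count P (iota 0 Q)).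
have r0 := ler0n R (N %% Q).
have Ecount := count_modn P (N %/ Q) rQ; rewrite -divn_eq in Ecount.
rewrite /frequency Ecount natrD natrM.
move: EN N0' Q0' rQ' c0 C0 r0; move: (count _ _)%:R (count _ _)%:R N%:R Q%:R.
move: (N %/ Q)%:R (N %% Q)%:R => k r c' c n d EN n0 d0 rd c'0 c0 r0 c'r cd.
have -> : (k * c' + c) / n - c' / d = (c * d - c' * r) / (n * d).
  by rewrite [in RHS](_ : c * d - c' * r = (k * c' + c) * d - c' * n);
    [field; rewrite !gt_eqF|rewrite EN; ring].
rewrite normrM normfV (gtr0_norm (mulr_gt0 n0 d0)) ler_pdivrMr ?(mulr_gt0 n0 d0)//.
rewrite [leRHS](_ : _ = d * d); last by field; rewrite gt_eqF.
rewrite ler_norml; apply/andP; split; nra.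
Qed.
End frequency.

(** Both functions at y are compared with the distribution function G of f on one period [0, Q), at
    points shifted by w1 or w2; each reduction modulo Q costs a ratio Q / N. What remains is a
    difference of values of G, hence the frequency of an interval, which is carried over to n < N3
    by widening the interval by w3. N3 is left free so as to be a length at which concentration is
    known. *)
Lemma empirical_df_dist (R : realType) (f : nat -> R) Q N1 N2 N3 (w1 w2 w3 y : R) :
  (0 < Q)%N -> (0 < N1)%N -> (0 < N2)%N -> (0 < N3)%N ->
  (forall n, (n < N1)%N -> `|f n - f (n %% Q)%N| <= w1) ->
  (forall n, (n < N2)%N -> `|f n - f (n %% Q)%N| <= w2) ->
  (forall n, (n < N3)%N -> `|f n - f (n %% Q)%N| <= w3) ->
  `|empirical_df f N1 y - empirical_df f N2 y| <=
  frequency (fun n => `|f n - y| <= w1 + w2 + w3) N3 +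
  (Q%:R / N1%:R + Q%:R / N2%:R + Q%:R / N3%:R).
Proof.
move=> Q0 N10 N20 N30 fw1 fw2 fw3.
pose G z := frequency (fun n => f n <= z) Q : R.
have sandwich N w : (0 < N)%N -> (forall n, (n < N)%N -> `|f n - f (n %% Q)%N| <= w) ->
    G (y - w) - Q%:R / N%:R <= empirical_df f N y <= G (y + w) + Q%:R / N%:R.
  move=> N0 fw; rewrite empirical_dfE.
  have := frequency_modn (R := R) (fun n => f n <= y - w) Q0 N0.
  have := frequency_modn (R := R) (fun n => f n <= y + w) Q0 N0.
  rewrite -!/(G _) !ler_norml => /andP[_ h1] /andP[h2 _].
  have h3 : frequency (fun n => f (n %% Q)%N <= y - w) N <= frequency (fun n => f n <= y) N :> R.
    by apply: frequency_sub => n /fw; rewrite ler_norml => /andP[]; lra.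
  have h4 : frequency (fun n => f n <= y) N <= frequency (fun n => f (n %% Q)%N <= y + w) N :> R.
    by apply: frequency_sub => n /fw; rewrite ler_norml => /andP[]; lra.
  by apply/andP; split; lra.
have w_ge0 N w : (0 < N)%N -> (forall n, (n < N)%N -> `|f n - f (n %% Q)%N| <= w) -> 0 <= w.
  by move=> N0 /(_ 0%N N0); apply: le_trans.
have w10 := w_ge0 _ _ N10 fw1; have w20 := w_ge0 _ _ N20 fw2.
have Gdiff a b : y - w1 - w2 <= a -> b <= y + w1 + w2 ->
    G b - G a <= frequency (fun n => `|f n - y| <= w1 + w2) Q.
  move=> ha hb; rewrite /G /frequency -mulrBl ler_wpM2r ?invr_ge0// lerBlDr -natrD ler_nat.
  rewrite -count_predUI; apply: leq_trans (leq_addr _ _).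
  apply: sub_count => n /= fb; rewrite orbC; case: (lerP (f n) a) => //= af.
  by rewrite ler_norml; apply/andP; split; lra.
have conc : frequency (fun n => `|f n - y| <= w1 + w2) Q <=
    frequency (fun n => `|f n - y| <= w1 + w2 + w3) N3 + Q%:R / N3%:R :> R.
  have := frequency_modn (R := R) (fun n => `|f n - y| <= w1 + w2) Q0 N30.
  rewrite ler_norml => /andP[h _].
  have : frequency (fun n => `|f (n %% Q)%N - y| <= w1 + w2) N3 <=
         frequency (fun n => `|f n - y| <= w1 + w2 + w3) N3 :> R; last by lra.
  apply: frequency_sub => n /fw3; rewrite !ler_norml => /andP[h1 h2] /andP[h3 h4].
  by apply/andP; split; lra.
have /andP[lo1 up1] := sandwich _ _ N10 fw1.
have /andP[lo2 up2] := sandwich _ _ N20 fw2.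
have a1 : y - w1 - w2 <= y - w2 by lra.
have b1 : y + w1 <= y + w1 + w2 by lra.
have a2 : y - w1 - w2 <= y - w1 by lra.
have b2 : y + w2 <= y + w1 + w2 by lra.
have := Gdiff _ _ a1 b1; have := Gdiff _ _ a2 b2.
by rewrite ler_norml => h1 h2; apply/andP; split; lra.
Qed.

(** * Concentration of the values of f on the integers below q^m *)

Section concentration.
Context {R : realType} (q : nat) (f : nat -> R).
Context (q2 : (2 <= q)%N).
Context (fq : q_additive q f).
Local Notation mu := (@lebesgue_measure R).

(** Leading digits are removed one by one; removing the one at position j changes f, in absolute
    value, by a single term of [digit_abs q f j]. *)
Lemma q_additive_modn m K n : (m <= K)%N -> (n < q ^ K)%N ->
  `|f n - f (n %% q ^ m)%N| <= \sum_(m <= j < K) digit_abs q f j.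
Proof.
have q0 : (0 < q)%N by exact: leq_trans q2.
move=> mK; rewrite -(subnKC mK); elim: (K - m)%N n => {mK K} [|k IHk] n nK.
  by rewrite addn0 in nK *; rewrite modn_small// subrr normr0 big_geq.
rewrite addnS big_nat_recr ?leq_addr//=.
have aK : (n %% q ^ (m + k) < q ^ (m + k))%N by rewrite ltn_mod expn_gt0 q0.
have dq : (n %/ q ^ (m + k) < q)%N by rewrite ltn_divLR ?expn_gt0 ?q0// -expnS -addnS.
rewrite {1}(divn_eq n (q ^ (m + k))) addnC (q_additiveD q2 fq aK dq).
have -> : (n %% q ^ m = (n %% q ^ (m + k)) %% q ^ m)%N.
  by rewrite modn_dvdm// dvdn_exp2l// leq_addr.
rewrite addrAC (le_trans (ler_normD _ _))// lerD ?IHk//.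
rewrite /digit_abs (bigD1 (Ordinal dq))//= lerDl sumr_ge0//.
Qed.

(** Triangle weight times the real part of the characteristic function at t of f(n) - y, for n
    uniform below q^m. *)
Definition fejer_average m U y t : R :=
  (q ^ m)%N%:R^-1 * \sum_(n <- iota 0 (q ^ m)%N) fejer_kernel U (f n - y) t.

Lemma fejer_average_continuous m U y : 0 < U -> continuous (fejer_average m U y).
Proof.
move=> U0 t; apply: cvgMr.
exact: (Rintegral_sum_fejer_kernel (iota 0 (q ^ m)%N) (fun n => f n - y) U0).1.
Qed.

Lemma fejer_averageE m U y t : fejer_average m U y t =
  (1 - t / U) * ((q ^ m)%N%:R^-1 * \sum_(n < q ^ m) cos (t * (f n - y))).
Proof.
rewrite /fejer_average mulrCA; congr (_ * _).
rewrite -[X in iota 0 X](subn0 (q ^ m)%N) -/(index_iota 0 (q ^ m)%N) big_mkord mulr_sumr.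
by apply: eq_bigr.
Qed.

Lemma fejer_average_bounded m U y t : 0 < U -> 0 <= t <= U -> `|fejer_average m U y t| <= 1.
Proof.
move=> U0 /andP[t0 tU]; have qm0 : (0 < q ^ m)%N by rewrite expn_gt0 (leq_trans _ q2).
rewrite fejer_averageE normrM -[leRHS]mulr1 ler_pM//.
  have tU0 : 0 <= t / U by rewrite divr_ge0// ltW.
  have tU1 : t / U <= 1 by rewrite ler_pdivrMr// mul1r.
  by rewrite ler_norml; apply/andP; split; lra.
rewrite normrM ger0_norm ?invr_ge0// mulrC ler_pdivrMr ?ltr0n// mul1r.
apply: le_trans (ler_norm_sum _ _ _) _.
rewrite -[X in _ <= X%:R](card_ord (q ^ m)%N) -sum1_card natr_sum ler_sum// => n _.
exact: cos_max.
Qed.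

Lemma fejer_average_le m U y t : 0 < U -> 0 <= t <= U ->
  fejer_average m U y t <= expR (- c1 R q * t ^+ 2 * small_sq_upto q f m t).
Proof.
move=> U0 /andP[t0 tU]; have qm0 : (0 < q ^ m)%N by rewrite expn_gt0 (leq_trans _ q2).
have tU0 : 0 <= t / U by rewrite divr_ge0// ltW.
have tU1 : t / U <= 1 by rewrite ler_pdivrMr// mul1r.
have h : (q ^ m)%N%:R^-1 * \sum_(n < q ^ m) cos (t * (f n - y)) <=
    expR (- c1 R q * t ^+ 2 * small_sq_upto q f m t).
  by rewrite mulrC ler_pdivrMr ?ltr0n// mulrC; exact: sum_cos_le.
rewrite fejer_averageE.
apply: (@le_trans _ _ ((1 - t / U) * expR (- c1 R q * t ^+ 2 * small_sq_upto q f m t))).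
  by rewrite ler_wpM2l// subr_ge0.
by rewrite ler_piMl ?expR_ge0//; lra.
Qed.

(* Esseen's concentration inequality *)
Lemma concentration m U y : 0 < U ->
  2 / pi ^+ 2 * U * frequency (fun n => `|f n - y| <= U^-1) (q ^ m)%N <=
  \int[mu]_(t in `[0, U]) fejer_average m U y t.
Proof.
move=> U0; have qm0 : (0 < q ^ m)%N by rewrite expn_gt0 (leq_trans _ q2).
have [cS le] := Rintegral_sum_fejer_kernel (iota 0 (q ^ m)%N) (fun n => f n - y) U0.
have -> : \int[mu]_(t in `[0, U]) fejer_average m U y t = (q ^ m)%N%:R^-1 *
    \int[mu]_(t in `[0, U]) \sum_(n <- iota 0 (q ^ m)%N) fejer_kernel U (f n - y) t.
  rewrite -RintegralZl//; exact: integrable_continuous.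
rewrite [leRHS]mulrC ler_pdivlMr ?ltr0n//; apply: le_trans le.
rewrite /frequency -!mulrA mulVf ?pnatr_eq0 -?lt0n// mulr1 !mulrA.
rewrite ler_wpM2l//; first by rewrite !mulr_ge0 ?invr_ge0 ?exprn_ge0 ?pi_ge0 ?(ltW U0).
(* The Fejer bound covers U |f n - y| <= pi; only the smaller range up to 1 is kept. *)
rewrite ler_nat; apply: sub_count => n /= nU.
rewrite normrM gtr0_norm// mulrC -ler_pdivlMr//.
apply: le_trans nU _; rewrite -[leLHS]mul1r ler_wpM2r ?invr_ge0 ?(ltW U0)//.
by rewrite (le_trans _ (pi_ge2 R))// ler1n.
Qed.
End concentration.

Lemma ler_sum_uniq_subset (R : numDomainType) (T : eqType) (s s' : seq T)
    (P : pred T) (F : T -> R) :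
  (forall x, P x -> 0 <= F x) -> uniq s -> uniq s' ->
  (forall x, x \in s -> P x -> x \in s') ->
  \sum_(x <- s | P x) F x <= \sum_(x <- s' | P x) F x.
Proof.
move=> F0 us us' ss'; rewrite [leRHS](bigID (mem s))/= -[leLHS]addr0 lerD//; last first.
  by apply: sumr_ge0 => x /andP[/F0].
rewrite -big_filter -[leRHS]big_filter le_eqVlt; apply/orP; left; apply/eqP/perm_big.
apply: uniq_perm; rewrite ?filter_uniq// => x.
rewrite !mem_filter; case: (boolP (P x)) => //= Px; apply/idP/idP => [xs|/andP[]//].
by rewrite xs ss'.
Qed.

(** * Sums over positions and over pairs of a digit and a position *)

Section digit_sums.
Context {R : realType} (q : nat) (f : nat -> R).
Context (q2 : (2 <= q)%N).
Context (cvgf : cvgn (series (digit_mean_abs q f))).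

(** The factor q undoes the mean: this is the sum of all [digit_abs q f j], expressed by the limit
    on which the constant may depend. *)
Definition digit_total : R := q%:R * limn (series (digit_mean_abs q f)).

Let qR0 : 0 < q%:R :> R. Proof. by rewrite ltr0n (leq_trans _ q2). Qed.

Lemma digit_abs_ge0 j : 0 <= digit_abs q f j.
Proof. by rewrite sumr_ge0. Qed.

Lemma sum_digit_absE J : \sum_(0 <= j < J) digit_abs q f j =
  q%:R * series (digit_mean_abs q f) J.
Proof.
rewrite /series/= mulr_sumr; apply: eq_bigr => j _.
by rewrite /digit_mean_abs mulrA divff ?mul1r// gt_eqF.
Qed.

Lemma series_mean_nd : nondecreasing_seq (series (digit_mean_abs q f)).
Proof.
apply/nondecreasing_seqP => n.
by rewrite /series/= big_nat_recr//= lerDl mulr_ge0 ?invr_ge0// digit_abs_ge0.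
Qed.

Lemma sum_digit_abs_le J : \sum_(0 <= j < J) digit_abs q f j <= digit_total.
Proof.
rewrite sum_digit_absE ler_pM2l//.
exact: nondecreasing_cvgn_le series_mean_nd cvgf J.
Qed.

Lemma digit_total_ge0 : 0 <= digit_total.
Proof. by apply: le_trans (sum_digit_abs_le 0); rewrite big_geq. Qed.

Lemma sum_digit_abs_between_le K J : \sum_(K <= j < J) digit_abs q f j <= digit_total.
Proof.
have [KJ|JK] := leqP K J; last by rewrite big_geq ?digit_total_ge0// ltnW.
apply: le_trans (sum_digit_abs_le J); rewrite [leRHS](big_cat_nat (n := K))//= lerDr.
by rewrite sumr_ge0// => j _; exact: digit_abs_ge0.
Qed.

Lemma digit_tail_small e : 0 < e ->
  \forall K \near \oo, forall J, \sum_(K <= j < J) digit_abs q f j <= e.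
Proof.
move=> e0; have eq0 : 0 < e / q%:R by rewrite divr_gt0.
move/cvgrPdist_le : cvgf => /(_ _ eq0); apply: filterS => K hK J.
have [KJ|JK] := leqP K J; last by rewrite big_geq ?ltW// ltnW.
have := sum_digit_abs_le J; rewrite (big_cat_nat (n := K))//= sum_digit_absE /digit_total.
move: hK; rewrite ler_norml => /andP[_]; rewrite ler_pdivlMr// mulrBl => h1 h2; lra.
Qed.

(** Partial sums are bounded by [digit_total], so the extended series is finite and [fine] keeps its
    value. *)
Lemma tail_sum_bounds L :
  (forall J, \sum_(L.+1 <= j < J) digit_abs q f j <= tail_sum q f L) /\
  tail_sum q f L <= digit_total.
Proof.
have ge0 j : (0 <= (digit_abs q f j)%:E)%E by rewrite lee_fin digit_abs_ge0.
have le_total : (\sum_(L.+1 <= j <oo) (digit_abs q f j)%:E <= digit_total%:E)%E.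
  apply: lime_le; first exact: is_cvg_nneseries.
  by apply: nearW => J; rewrite sumEFin lee_fin sum_digit_abs_between_le.
have ge0s : (0 <= \sum_(L.+1 <= j <oo) (digit_abs q f j)%:E)%E by exact: nneseries_ge0.
have fin : (\sum_(L.+1 <= j <oo) (digit_abs q f j)%:E)%E \is a fin_num.
  by rewrite ge0_fin_numE// (le_lt_trans le_total)// ltry.
split=> [J|]; last by rewrite -lee_fin fineK.
by rewrite -lee_fin fineK// -sumEFin; apply: nneseries_lim_ge.
Qed.

Lemma sum_sq_ge0 (A : set (nat * nat)) : 0 <= sum_sq q f A.
Proof. by rewrite fine_ge0// esum_ge0// => p _; rewrite lee_fin sqr_ge0. Qed.

(** The extended sum is a supremum over finite subsets of A, each of which lies in a box of digits
    below q and positions below some J. *)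
Lemma sum_sq_le (A : set (nat * nat)) x : A `<=` digit_pairs q ->
  (forall J, \sum_(j < J) \sum_(d < q | (nat_of_ord d, nat_of_ord j) \in A)
     f (d * q ^ j)%N ^+ 2 <= x) ->
  sum_sq q f A <= x.
Proof.
move=> Aq hx; have x0 : 0 <= x by apply: le_trans (hx 0%N); rewrite big_ord0.
have le_esum : (\esum_(p in A) (f (p.1 * q ^ p.2)%N ^+ 2)%:E <= x%:E)%E.
  apply/ge_ereal_sup => _ [X [finX XA] <-]; rewrite fsbig_finite// sumEFin lee_fin.
  pose s := finmap.enum_fset (fset_set X); pose J := (\max_(p <- s) p.2.+1)%N.
  apply: le_trans (hx J); rewrite -/s.
  have sX p : p \in s -> X p by rewrite in_fset_set// => /set_mem.
  have -> : \sum_(p <- s) f (p.1 * q ^ p.2)%N ^+ 2 =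
      \sum_(p <- s | p \in A) f (p.1 * q ^ p.2)%N ^+ 2.
    rewrite [LHS]big_seq [RHS]big_seq_cond; apply: eq_bigl => p.
    by case: (boolP (p \in s)) => //= /sX/XA/mem_set ->.
  have -> : \sum_(j < J) \sum_(d < q | (nat_of_ord d, nat_of_ord j) \in A) f (d * q ^ j)%N ^+ 2 =
      \sum_(p <- [seq (d, j) | j <- iota 0 J, d <- iota 0 q] | p \in A) f (p.1 * q ^ p.2)%N ^+ 2.
    rewrite [RHS]big_mkcond big_allpairs_dep.
    rewrite -[X in iota 0 X](subn0 J) -/(index_iota 0 J) big_mkord; apply: eq_bigr => j _.
    rewrite -[X in iota 0 X](subn0 q) -/(index_iota 0 q) big_mkord [LHS]big_mkcond.
    exact: eq_bigr.
  apply: ler_sum_uniq_subset => [p _|||p ps pA]; first exact: sqr_ge0.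
  - exact: finmap.fset_uniq.
  - by apply: allpairs_uniq; rewrite ?iota_uniq// => -[? ?] [? ?] _ _ /= [-> ->].
  - apply/allpairsP; exists (p.2, p.1); rewrite !mem_iota/= !add0n; split.
    + by apply: (@leq_bigmax_seq _ s xpredT (fun p => p.2.+1)).
    + by have /andP[] := Aq p (set_mem pA).
    + by case: p {ps pA}.
rewrite -lee_fin fineK// ge0_fin_numE; first exact: le_lt_trans le_esum (ltry _).
by apply: esum_ge0 => p _; rewrite lee_fin sqr_ge0.
Qed.

Lemma small_pairs_normM t d j : 0 < t ->
  ((d, j) : nat * nat) \in small_pairs q f t -> `|t * f (d * q ^ j)%N| <= pi.
Proof.
move=> t0; rewrite inE => -[_ /=]; rewrite normrM (gtr0_norm t0).
by rewrite ler_pdivlMr// mulrC.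
Qed.

(** On S(t) one has f^2 <= (pi / t) |f|, so the positions from K on contribute at most (pi / t) r;
    below K the squares are kept. *)
Lemma sum_sq_small_le K t r : 0 <= t ->
  (forall J, \sum_(K <= j < J) digit_abs q f j <= r) ->
  t ^+ 2 * sum_sq q f (small_pairs q f t) <= t ^+ 2 * small_sq_upto q f K t + pi * t * r.
Proof.
rewrite le_eqVlt => /predU1P[<- _|t0 hr]; first by rewrite expr0n !mul0r mulr0 mul0r addr0.
have r0 : 0 <= r by apply: le_trans (hr 0%N); rewrite big_geq.
have t20 : 0 < t ^+ 2 by rewrite exprn_gt0.
suff h : sum_sq q f (small_pairs q f t) <= small_sq_upto q f K t + pi / t * r.
  apply: (@le_trans _ _ (t ^+ 2 * (small_sq_upto q f K t + pi / t * r))); first by rewrite ler_pM2l.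
  rewrite mulrDr lerD2l le_eqVlt; apply/orP; left; apply/eqP.
  by move: (pi : R) => p; field; rewrite gt_eqF.
apply: sum_sq_le => [p []//|J].
pose X j := \sum_(d < q | (nat_of_ord d, j) \in small_pairs q f t) f (d * q ^ j)%N ^+ 2.
rewrite -(big_mkord xpredT X).
have X1 j : X j <= small_sq q f t j.
  rewrite /X /small_sq [leLHS]big_mkcond [leRHS]big_mkcond ler_sum// => d _.
  case: ifPn => [/(small_pairs_normM t0) ->//|_].
  by case: ifP => // _; exact: sqr_ge0.
have X2 j : X j <= pi / t * digit_abs q f j.
  rewrite /X /digit_abs mulr_sumr [leLHS]big_mkcond ler_sum// => d _.
  case: ifPn => [|_]; last by rewrite mulr_ge0// divr_ge0 ?pi_ge0// ltW.
  rewrite inE => -[_ /=]; rewrite (gtr0_norm t0) => h.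
  by rewrite -(real_normK (num_real (f _))) expr2 ler_wpM2r.
have [JK|KJ] := leqP J K.
  apply: (@le_trans _ _ (small_sq_upto q f K t)); last first.
    by rewrite lerDl mulr_ge0// divr_ge0 ?pi_ge0// ltW.
  rewrite /small_sq_upto -(big_mkord xpredT (small_sq q f t)) [leRHS](big_cat_nat (n := J))//=.
  rewrite -[leLHS]addr0 lerD//; first by rewrite ler_sum.
  rewrite sumr_ge0// => j _; rewrite sumr_ge0// => d _; exact: sqr_ge0.
rewrite (big_cat_nat (n := K))//=; last exact: ltnW.
rewrite lerD//.
  by rewrite /small_sq_upto -(big_mkord xpredT (small_sq q f t)) ler_sum.
apply: (@le_trans _ _ (\sum_(K <= j < J) pi / t * digit_abs q f j)); first by rewrite ler_sum.
by rewrite -mulr_sumr ler_wpM2l// divr_ge0 ?pi_ge0// ltW.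
Qed.

Lemma sum_sq_small_upto_le L t : 0 < t ->
  sum_sq q f (small_pairs q f t `&` [set p | (p.2 <= L)%N]) <= small_sq_upto q f L.+1 t.
Proof.
move=> t0; apply: sum_sq_le => [p [[]]//|J].
rewrite -(big_mkord xpredT (fun j => \sum_(d < q | (nat_of_ord d, j) \in _) f (d * q ^ j)%N ^+ 2)).
apply: (@le_trans _ _ (\sum_(0 <= j < J | (0 <= j < L.+1)%N) small_sq q f t j)).
  rewrite [leRHS]big_mkcond ler_sum// => j _; case: ifPn => jL.
    rewrite /small_sq [leLHS]big_mkcond [leRHS]big_mkcond ler_sum// => d _.
    case: ifPn => [|_]; last by case: ifP => // _; exact: sqr_ge0.
    by rewrite inE => -[/mem_set/(small_pairs_normM t0) -> _].
  by rewrite big1// => d; rewrite inE => -[_ /=]; rewrite -ltnS => jL'; rewrite jL' in jL.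
rewrite /small_sq_upto -(big_mkord xpredT (small_sq q f t)).
rewrite [leRHS]big_nat; apply: ler_sum_uniq_subset => [j _|||j _ jL]; rewrite ?iota_uniq//.
  by apply: sumr_ge0 => d _; exact: sqr_ge0.
by rewrite mem_index_iota.
Qed.
End digit_sums.

(** * Bounds for 1/T and for concentration by the terms of the error *)

Section error_terms.
Context {R : realType} (q : nat) (f : nat -> R).
Context (q2 : (2 <= q)%N).
Context (fq : q_additive q f).
Context (cvgf : cvgn (series (digit_mean_abs q f))).
Local Notation mu := (@lebesgue_measure R).
Local Notation A := (digit_total q f).

Let pi0 : 0 < pi :> R. Proof. exact: pi_gt0. Qed.
Let qR0 : 0 < q%:R :> R. Proof. by rewrite ltr0n (leq_trans _ q2). Qed.

Lemma c1_gt0 : 0 < c1 R q.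
Proof. by rewrite /c1 divr_gt0// mulr_gt0 ?exprn_gt0. Qed.

Lemma expR_sum_sq_bounded (S : set (nat * nat)) t :
  0 <= expR (- c1 R q * t ^+ 2 * sum_sq q f S) <= 1.
Proof.
rewrite expR_ge0 expR_le1 !mulNr oppr_le0.
by rewrite mulr_ge0 ?sum_sq_ge0// mulr_ge0 ?sqr_ge0// ltW// c1_gt0.
Qed.

Lemma window_sumE L h : (h <= L)%N ->
  window_sum q f L h%:Z = \sum_(L.+1 - h <= j < L.+1) digit_abs q f j.
Proof.
move=> hL; rewrite /window_sum -(big_mkord (fun j : nat => (L%:Z - h%:Z + 1 <= j%:Z)%R)).
rewrite [RHS](big_nat_widenl _ 0)//; apply: eq_bigl => j /=; lia.
Qed.

Lemma window_sum_ge0 L (h : int) : 0 <= window_sum q f L h.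
Proof. by rewrite sumr_ge0// => j _; exact: digit_abs_ge0. Qed.

(** For T >= e the factor log T is at least 1, whence T <= T log T <= q^h and h >= 0. *)
Lemma le_pow_height (T : R) : expR 1 <= T ->
  exists2 h : nat, height q T = h%:Z & T <= (q ^ h)%N%:R.
Proof.
move=> eT; have T0 : 0 < T by apply: lt_le_trans eT; exact: expR_gt0.
have lnT : 1 <= ln T by rewrite -[1]expRK ler_ln ?posrE ?expR_gt0.
have TlnT : T <= T * ln T by rewrite ler_peMr// ltW.
have TlnT0 : 0 < T * ln T by exact: lt_le_trans TlnT.
have lnq : 0 < ln q%:R :> R by rewrite ln_gt0// ltr1n.
have x0 : 0 <= ln (T * ln T) / ln q%:R.
  by rewrite divr_ge0 ?(ltW lnq)// ln_ge0// (le_trans _ TlnT)// (le_trans _ eT)// ltW// expR_gt1.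
have : 0 <= height q T by rewrite /height -(ler_int R) (le_trans x0)// ceil_ge.
case E: (height q T) => [h|//] _; exists h => //.
apply: le_trans TlnT _.
rewrite -ler_ln ?posrE ?ltr0n ?expn_gt0 ?(leq_trans _ q2)//.
rewrite natrX lnXn// -[ln _ *+ _]mulr_natl -ler_pdivrMr//.
have := ceil_ge (ln (T * ln T) / ln q%:R); rewrite -/(height q T) E.
by [].
Qed.

(** The integral is restricted to [0, 1], where [sum_sq_small_le] with K = 0 shows that the exponent
    is at least -c1 pi A. *)
Lemma inv_le_first_term T : 1 <= T ->
  T^-1 <= expR (c1 R q * pi * A) * first_term q f T.
Proof.
move=> T1; have T0 : 0 < T by exact: lt_le_trans T1.
rewrite /first_term mulrCA -[leLHS]mulr1 ler_pM2l ?invr_gt0//.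
rewrite -ler_pdivrMl ?expR_gt0// mulr1 -expRN.
set E := expR _.
have -> : E = \int[mu]_(t in `[0, 1]) E.
  by rewrite Rintegral_cst//= lebesgue_measure_itv/= lte_fin ltr01 sube0 mulr1.
have A0 := digit_total_ge0 q2 cvgf.
have E01 : 0 <= E <= 1.
  by rewrite expR_ge0 expR_le1 oppr_le0 mulr_ge0// mulr_ge0 ?pi_ge0// ltW// c1_gt0.
apply: (@le_Rintegral_restrict _ 0 T _ _ _ _ 1); first exact: ltW.
- by move=> t /=; rewrite !in_itv/= => /andP[-> /le_trans]; exact.
- by [].
- by move=> t _; rewrite ger0_norm; case/andP: E01.
- by move=> t _; have /andP[? ?] := expR_sum_sq_bounded (small_pairs q f t) t; rewrite ger0_norm.
move=> t; rewrite /patch; case: ifPn => [|_]; last first.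
  by case: ifP => // _; exact: expR_ge0.
rewrite inE/= in_itv/= => /andP[t0 t1].
rewrite ifT; last by rewrite inE/= in_itv/= t0 (le_trans t1).
rewrite /E ler_expR !mulNr lerN2; have c0 := c1_gt0; move: (c1 R q) c0 => c c0.
rewrite -[c * _ * _ in leLHS]mulrA -[c * _ * _ in leRHS]mulrA ler_pM2l//.
have := @sum_sq_small_le R q f 0 t A t0 (fun J => sum_digit_abs_between_le q2 cvgf _ J).
rewrite /small_sq_upto big_ord0 mulr0 add0r => /le_trans; apply.
by rewrite -mulrA ler_pM2l// ler_piMl.
Qed.

Lemma first_term_ge0 T : 0 <= T -> 0 <= first_term q f T.
Proof. by move=> T0; rewrite mulr_ge0 ?invr_ge0// Rintegral_ge0// => t _; exact: expR_ge0. Qed.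

Lemma second_term_ge0 L T : 0 <= T -> 0 <= second_term q f L T.
Proof. by move=> T0; rewrite mulr_ge0// window_sum_ge0. Qed.

Lemma tail_sum_ge0 L : 0 <= tail_sum q f L.
Proof. by have [/(_ 0%N)] := tail_sum_bounds q2 cvgf L; rewrite big_geq. Qed.

Lemma third_term_ge0 L T : 0 < T -> 0 <= third_term q f L T.
Proof.
move=> T0; rewrite Rintegral_ge0// => t; rewrite /= in_itv/= => /andP[t0 _].
rewrite mulr_ge0 ?expR_ge0// le_min tail_sum_ge0 invr_ge0 addr_ge0// (le_trans _ t0)//.
by rewrite invr_ge0 ltW.
Qed.

(* [K] is large enough for the digits beyond [K] to change the exponent by at
   most 1. *)
Lemma concentration_first_term K y T x : 1 <= T ->
  (forall J, \sum_(K <= j < J) digit_abs q f j <= (c1 R q * pi * T)^-1) ->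
  x <= 5 / T ->
  frequency (fun n => `|f n - y| <= x) (q ^ K)%N <=
  5 / 2 * pi ^+ 2 * expR 1 * first_term q f T.
Proof.
move=> T1 hK xT; have T0 : 0 < T by exact: lt_le_trans T1.
(* Chosen so that 1/U = 5/T covers the allowed width x. *)
pose U := T / 5; have U0 : 0 < U by rewrite divr_gt0.
have UT : U <= T by rewrite ler_pdivrMr// ler_peMr ?(ltW T0)// ler1n.
apply: (@le_trans _ _ (frequency (fun n => `|f n - y| <= U^-1) (q ^ K)%N)).
  by apply: frequency_sub => n _ /le_trans; apply; rewrite invf_div.
have := concentration f q2 K y U0.
set P := frequency _ _; move=> conc.
have int_le : expR (- 1) * \int[mu]_(t in `[0, U]) fejer_average q f K U y t <=
    \int[mu]_(t in `[0, T]) expR (- c1 R q * t ^+ 2 * sum_sq q f (small_pairs q f t)).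
  rewrite -RintegralZl//; last first.
    by apply: integrable_continuous; exact: fejer_average_continuous.
  have e1 : expR (- 1) <= 1 :> R by rewrite expR_le1 oppr_le0.
  apply: (@le_Rintegral_restrict _ 0 T _ _ _ _ 1); first exact: ltW.
  - by move=> t /=; rewrite !in_itv/= => /andP[-> /le_trans]; exact.
  - by [].
  - move=> t /=; rewrite in_itv/= => tU.
    rewrite normrM ger0_norm ?expR_ge0// mulr_ile1// ?expR_ge0//.
    exact: fejer_average_bounded.
  - by move=> t _; have /andP[? ?] := expR_sum_sq_bounded (small_pairs q f t) t; rewrite ger0_norm.
  move=> t; rewrite /patch; case: ifPn => [|_]; last first.
    by case: ifP => // _; exact: expR_ge0.
  rewrite inE/= in_itv/= => /andP[t0 tU].
  rewrite ifT; last by rewrite inE/= in_itv/= t0 (le_trans tU).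
  apply: (@le_trans _ _ (expR (-1) * expR (- c1 R q * t ^+ 2 * small_sq_upto q f K t))).
    by rewrite ler_wpM2l ?expR_ge0// fejer_average_le// t0.
  rewrite -expRD ler_expR.
  have := sum_sq_small_le t0 hK.
  have c0 := c1_gt0; move: (c1 R q) (small_sq_upto q f K t) (sum_sq q f _) c0 => c s S c0.
  rewrite -(ler_pM2l c0) mulrDr.
  (* The tail bound [hK] is calibrated to make this loss in the exponent equal to t / T; the factor
     exp(-1) in [int_le] pays for it. *)
  have : c * (pi * t * (c * pi * T)^-1) <= 1.
    rewrite [leLHS](_ : _ = t / T); first by rewrite ler_pdivrMr// mul1r (le_trans tU).
    by move: (pi : R) pi0 => p p0; field; rewrite !gt_eqF.
  move: (pi * t * _) => r; rewrite !mulNr !mulrA; lra.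
have -> : first_term q f T = T^-1 * \int[mu]_(t in `[0, T])
   expR (- c1 R q * t ^+ 2 * sum_sq q f (small_pairs q f t)) by [].
move: int_le conc; move: (\int[mu]_(t in `[0, U]) _) (\int[mu]_(t in `[0, T]) _) => I1 I2.
rewrite expRN mulrC ler_pdivrMr ?expR_gt0// => I12 /le_trans /(_ I12).
rewrite mulrC -ler_pdivlMr; last by rewrite mulr_gt0// divr_gt0// exprn_gt0.
move=> /le_trans; apply; rewrite le_eqVlt; apply/orP; left; apply/eqP.
move: (expR 1) (pi : R) pi0 => e p p0.
by rewrite /U; field; rewrite !gt_eqF.
Qed.

(** Esseen's inequality at U = 1/(4 tau) gives a factor of order tau. On [0, 1/T] the integrand is
    at most 1, which yields A/T; on (1/T, U] the factor tau is comparable to the minimum in the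
    third term. *)
Lemma concentration_third_term L y T x : 1 <= T -> 4 * A <= T ->
  T^-1 < tail_sum q f L -> x <= 4 * tail_sum q f L ->
  frequency (fun n => `|f n - y| <= x) (q ^ L.+1)%N <=
  2 * pi ^+ 2 * (A / T + (1 + 4 * A) * third_term q f L T).
Proof.
move=> T1 AT; have [_] := tail_sum_bounds q2 cvgf L.
set tau := tail_sum q f L => tauA Ttau xtau.
have T0 : 0 < T by exact: lt_le_trans T1.
have tau0 : 0 < tau by rewrite (lt_trans _ Ttau)// invr_gt0.
have A0 : 0 < A by exact: lt_le_trans tauA.
(* The condition 4A <= T gives 1/T <= U, and 1/T < tau gives U <= T. *)
pose U := (4 * tau)^-1; have U0 : 0 < U by rewrite invr_gt0 mulr_gt0.
have TU : T^-1 <= U by rewrite lef_pV2 ?posrE ?mulr_gt0// (le_trans _ AT)// ler_pM2l.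
have UT : U <= T.
  rewrite -[leRHS]invrK lef_pV2 ?posrE ?invr_gt0 ?mulr_gt0// (le_trans (ltW Ttau))//.
  by rewrite ler_peMl ?(ltW tau0)// ler1n.
apply: (@le_trans _ _ (frequency (fun n => `|f n - y| <= U^-1) (q ^ L.+1)%N)).
  by apply: frequency_sub => n _ /le_trans; apply; rewrite invrK.
have := concentration f q2 L.+1 y U0.
set P := frequency _ _; move=> conc.
have kc := fejer_average_continuous (q := q) (f := f) (m := L.+1) (y := y) U0.
have kint a b := integrable_continuous a b kc.
have split_int : \int[mu]_(t in `[0, U]) fejer_average q f L.+1 U y t =
    \int[mu]_(t in `[0, T^-1]) fejer_average q f L.+1 U y t +
    \int[mu]_(t in `]T^-1, U]) fejer_average q f L.+1 U y t.
  rewrite -(@Rintegral_itvB _ _ (BLeft 0) (BRight U) T^-1 (kint 0 U)).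
  - by rewrite addrC subrK.
  - by rewrite bnd_simp invr_ge0 ltW.
  - by rewrite bnd_simp.
have int1 : \int[mu]_(t in `[0, T^-1]) fejer_average q f L.+1 U y t <= T^-1.
  apply: (@le_trans _ _ (\int[mu]_(t in `[0, T^-1]) 1)).
    apply: (@le_Rintegral_bounded _ _ _ _ _ 1); first by rewrite invr_ge0 ltW.
    move=> t /andP[t0 tT]; have b1 : `|fejer_average q f L.+1 U y t| <= 1.
      by apply: fejer_average_bounded => //; rewrite t0 (le_trans tT).
    by rewrite normr1; split=> //; apply: le_trans b1; exact: ler_norm.
  by rewrite Rintegral_cst//= lebesgue_measure_itv/= lte_fin invr_gt0 T0 sube0 mul1r.
(* For t <= U one has tau t <= 1/4, hence tau (1 + t) <= 1 + 4A: this s is below both arguments of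
   the minimum. *)
pose s := tau / (1 + 4 * A).
have A41 : 0 < 1 + 4 * A by rewrite addr_gt0// mulr_gt0.
have s0 : 0 < s by rewrite divr_gt0.
have s1 : s <= 1 by rewrite ler_pdivrMr//; lra.
have int2 : s * \int[mu]_(t in `]T^-1, U]) fejer_average q f L.+1 U y t <= third_term q f L T.
  rewrite -RintegralZl//; last first.
    apply: integrableS (kint T^-1 U) => //; exact: subset_itv_oc_cc.
  have Tinv0 : 0 < T^-1 by rewrite invr_gt0.
  have h0 t : T^-1 <= t -> 0 <= Num.min (1 + t)^-1 tau <= 1.
    move=> t0; have t0' : 0 < t by exact: lt_le_trans t0.
    rewrite le_min (ltW tau0) invr_ge0 addr_ge0// ?(ltW t0')//= ge_min.
    by rewrite invf_le1 ?addr_gt0// lerDl (ltW t0').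
  apply: (@le_Rintegral_restrict _ T^-1 T _ _ _ _ 1); first exact: le_trans UT.
  - by move=> t /=; rewrite !in_itv/= => /andP[/ltW -> /le_trans]; exact.
  - by [].
  - move=> t /=; rewrite in_itv/= => /andP[tT tU].
    rewrite normrM gtr0_norm// mulr_ile1// ?(ltW s0)//.
    by apply: fejer_average_bounded => //; rewrite tU (le_trans _ (ltW tT))// ltW.
  - move=> t /=; rewrite in_itv/= => /andP[/h0/andP[? ?] _].
    have /andP[? ?] := expR_sum_sq_bounded (small_pairs q f t `&` [set p | (p.2 <= L)%N]) t.
    by rewrite ger0_norm ?mulr_ge0// mulr_ile1.
  move=> t; rewrite /patch; case: ifPn => [|_]; last first.
    case: ifPn => //; rewrite inE/= in_itv/= => /andP[/h0/andP[? ?] _].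
    by rewrite mulr_ge0// expR_ge0.
  rewrite inE/= in_itv/= => /andP[tT tU].
  have t0 : 0 < t by exact: lt_trans tT.
  rewrite ifT; last by rewrite inE/= in_itv/= (ltW tT) (le_trans tU).
  apply: (@le_trans _ _ (s * expR (- c1 R q * t ^+ 2 * small_sq_upto q f L.+1 t))).
    by rewrite ler_pM2l// fejer_average_le// (ltW t0).
  apply: ler_pM; rewrite ?(ltW s0) ?expR_ge0//.
    rewrite le_min; apply/andP; split.
      rewrite /s ler_pdivrMr// mulrC ler_pdivlMr ?addr_gt0// mulrDr mulr1.
      have : tau * t <= 4^-1; last by lra.
      have := ler_wpM2l (ltW tau0) tU; rewrite /U => /le_trans; apply.
      by rewrite invfM mulrCA divff ?mulr1// gt_eqF.
    by rewrite /s ler_pdivrMr// ler_peMr ?(ltW tau0)//; lra.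
  rewrite ler_expR !mulNr lerN2 ler_wpM2l//.
    by rewrite mulr_ge0 ?sqr_ge0 ?(ltW c1_gt0).
  exact: sum_sq_small_upto_le.
rewrite split_int in conc; move: conc int1 int2.
move: (\int[mu]_(t in `[0, T^-1]) _) (\int[mu]_(t in `]T^-1, U]) _).
move: (third_term _ _ _ _) => I3 I1 I2.
move=> conc int1 int2.
have {}int2 : tau * I2 <= (1 + 4 * A) * I3.
  by rewrite -ler_pdivrMl// (le_trans _ int2)// /s le_eqVlt mulrA [_^-1 * _]mulrC eqxx.
have tauT : tau * I1 <= A / T.
  apply: (@le_trans _ _ (tau / T)); first by rewrite ler_pM2l.
  by rewrite ler_pM2r// invr_gt0.
have pU0 : 0 < 2 / pi ^+ 2 * U by rewrite mulr_gt0// divr_gt0// exprn_gt0.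
move: conc; rewrite mulrC -ler_pdivlMr// => /le_trans; apply.
rewrite (_ : (I1 + I2) / _ = 2 * pi ^+ 2 * (tau * I1 + tau * I2)); last first.
  by rewrite /U; move: (pi : R) pi0 => p p0; field; rewrite !gt_eqF.
by rewrite ler_pM2l ?mulr_gt0 ?exprn_gt0// lerD.
Qed.
End error_terms.

(** The factor e converts 1/T into the first term by [inv_le_first_term]. It multiplies the
    coefficients of 1/T: expR 1 + 4A for small T, 3q for the ratios Q / N, and 2 pi^2 A from
    [concentration_third_term]. The last bracket collects the coefficients of the second, first and
    third terms, in this order. *)
Definition error_constant (R : realType) (q : nat) (A : R) : R :=
  let e := expR (c1 R q * pi * A) in
  (expR 1 + 4 * A + 3 * q%:R + 2 * pi ^+ 2 * A) * e +
  (1 + 5 / 2 * pi ^+ 2 * expR 1 + 2 * pi ^+ 2 * (1 + 4 * A)).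

Lemma frequency_dist_le1 (R : realType) (P P' : pred nat) N N' :
  `|frequency P N - frequency P' N'| <= 1 :> R.
Proof.
have b Q M : 0 <= (frequency Q M : R) <= 1.
  have [->|M0] := posnP M; first by rewrite /frequency mul0r lexx ler01.
  rewrite /frequency divr_ge0//= ler_pdivrMr ?ltr0n// mul1r ler_nat.
  by rewrite -{2}(size_iota 0 M) count_size.
have /andP[? ?] := b P N; have /andP[? ?] := b P' N'.
by rewrite ler_norml; apply/andP; split; lra.
Qed.

(** * Distance between the empirical distribution functions at N and at a large power of q *)

Section distance_bound.
Context {R : realType} (q : nat) (f : nat -> R).
Context (q2 : (2 <= q)%N).
Context (fq : q_additive q f).
Context (cvgf : cvgn (series (digit_mean_abs q f))).
Local Notation A := (digit_total q f).

(** Everything is reduced modulo q^m with m = L + 1 - h. Below q^(L+1) this costs the window w, at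
    most 1/T because the second term is at most 1; below q^K it costs w plus the tail tau. If tau <=
    1/T, concentration is used at q^K and gives the first term; otherwise it is used at q^(L+1),
    whose digits are those of the third term. *)
Lemma empirical_df_dist_large L N T y :
  (q ^ L <= N < q ^ L.+1)%N -> expR 1 + 4 * A <= T -> height q T <= L%:Z ->
  second_term q f L T <= 1 ->
  \forall K \near \oo,
    `|empirical_df f N y - empirical_df f (q ^ K)%N y| <=
    5 / 2 * pi ^+ 2 * expR 1 * first_term q f T +
    2 * pi ^+ 2 * (A / T + (1 + 4 * A) * third_term q f L T) + 3 * q%:R / T.
Proof.
move=> /andP[LN NL] eT hL sec1.
have A0 := digit_total_ge0 q2 cvgf.
have q0 : (0 < q)%N by exact: leq_trans q2.
have e1 : 1 < expR 1 :> R by rewrite expR_gt1.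
have T1 : 1 <= T by lra.
have T0 : 0 < T by exact: lt_le_trans T1.
have [|h Eh hT] := @le_pow_height R q q2 T; first by lra.
have {}hL : (h <= L)%N by move: hL; rewrite Eh.
have wT : window_sum q f L h%:Z <= T^-1.
  by rewrite -(ler_pM2l T0) divff ?gt_eqF// -Eh.
set w := window_sum q f L h%:Z in wT; pose tau := tail_sum q f L.
pose m := (L.+1 - h)%N.
(* Indeed q^m / n <= q^(L+1-h) / q^L = q / q^h <= q / T. *)
have QT n : (q ^ L <= n)%N -> (q ^ m)%N%:R / n%:R <= q%:R / T.
  move=> Ln; have n0 : (0 < n)%N by apply: leq_trans Ln; rewrite expn_gt0 q0.
  rewrite ler_pdivrMr ?ltr0n// mulrAC ler_pdivlMr//.
  apply: (@le_trans _ _ ((q ^ m)%N%:R * (q ^ h)%N%:R)); first by rewrite ler_wpM2l.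
  by rewrite -!natrM ler_nat -expnD subnK ?leqW// expnS leq_mul.
have fN n : (n < q ^ L.+1)%N -> `|f n - f (n %% q ^ m)%N| <= w.
  by move=> nL; rewrite /w window_sumE//; apply: q_additive_modn => //; rewrite leq_subr.
have fK K n : (L.+1 <= K)%N -> (n < q ^ K)%N -> `|f n - f (n %% q ^ m)%N| <= w + tau.
  move=> LK nK; have mK : (m <= K)%N by rewrite (leq_trans _ LK)// leq_subr.
  apply: le_trans (q_additive_modn q2 fq mK nK) _.
  rewrite (big_cat_nat (n := L.+1)) ?leq_subr//= /w window_sumE// lerD2l.
  exact: (tail_sum_bounds q2 cvgf L).1.
have qm0 : (0 < q ^ m)%N by rewrite expn_gt0 q0.
have N0 : (0 < N)%N by apply: leq_trans LN; rewrite expn_gt0 q0.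
have first0 := @first_term_ge0 R q f T (ltW T0).
have third0 := third_term_ge0 q2 cvgf L T0.
have w0 : 0 <= w by exact: window_sum_ge0.
have tau0 : 0 <= tau by exact: tail_sum_ge0.
have pi20 : 0 < pi ^+ 2 :> R by rewrite exprn_gt0// pi_gt0.
have c0 : 0 < (c1 R q * pi * T)^-1 by rewrite invr_gt0 mulr_gt0// mulr_gt0 ?pi_gt0// c1_gt0.
have tauA : tau <= A := (tail_sum_bounds q2 cvgf L).2.
have QL K : (L.+1 <= K)%N -> (q ^ L <= q ^ K)%N.
  by move=> LK; rewrite leq_pexp2l// ltnW.
near=> K.
have LK : (L.+1 <= K)%N by near: K; exact: nbhs_infty_ge.
have tailK : forall J, \sum_(K <= j < J) digit_abs q f j <= (c1 R q * pi * T)^-1.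
  by near: K; exact: digit_tail_small.
have qK0 : (0 < q ^ K)%N by rewrite expn_gt0 q0.
have third_ge0 : 0 <= 2 * pi ^+ 2 * (A / T + (1 + 4 * A) * third_term q f L T).
  apply: mulr_ge0; first by rewrite mulr_ge0 ?(ltW pi20).
  by apply: addr_ge0; [rewrite divr_ge0// ltW | apply: mulr_ge0 => //; lra].
have first_ge0 : 0 <= 5 / 2 * pi ^+ 2 * expR 1 * first_term q f T.
  by rewrite mulr_ge0// mulr_ge0 ?expR_ge0// mulr_ge0 ?(ltW pi20).
have [tauT|Ttau] := lerP tau T^-1.
  have := empirical_df_dist y qm0 N0 qK0 qK0 (fun n nN => fN n (ltn_trans nN NL))
    (fun n => fK K n LK) (fun n => fK K n LK).
  move=> /le_trans; apply.
  (* Three windows and two tails, each at most 1/T: the origin of the 5. *)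
  have x_le : w + (w + tau) + (w + tau) <= 5 / T by lra.
  have := concentration_first_term q2 fq y T1 tailK x_le.
  have := QT _ LN; have := QT _ (QL _ LK).
  rewrite -[3 * q%:R / T]mulrA; move: (q%:R / T) (_ / N%:R) (_ / (q ^ K)%N%:R) => a b c; lra.
have qL0 : (0 < q ^ L.+1)%N by rewrite expn_gt0 q0.
have := empirical_df_dist y qm0 N0 qK0 qL0 (fun n nN => fN n (ltn_trans nN NL))
  (fun n => fK K n LK) fN.
move=> /le_trans; apply.
(* Here w <= 1/T < tau, and the third length q^(L+1) brings in no tail. *)
have x_le : w + (w + tau) + w <= 4 * tau by lra.
have AT : 4 * A <= T by lra.
have := concentration_third_term q2 fq cvgf y T1 AT Ttau x_le.
have := QT _ LN; have := QT _ (QL _ LK); have := QT _ (QL _ (leqnn _)).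
rewrite -[3 * q%:R / T]mulrA.
move: (q%:R / T) (_ / N%:R) (_ / (q ^ K)%N%:R) (_ / (q ^ L.+1)%N%:R) => a b c d; lra.
Unshelve. all: by end_near.
Qed.

(** Two distribution functions differ by at most 1. This settles T < expR 1 + 4A, where 1/T is
    bounded below, and the case of a second term at least 1; otherwise [empirical_df_dist_large]
    applies. *)
Lemma empirical_df_dist_le L N T y :
  (q ^ L <= N < q ^ L.+1)%N -> 1 <= T -> height q T <= L%:Z ->
  \forall K \near \oo,
    `|empirical_df f N y - empirical_df f (q ^ K)%N y| <=
    error_constant q A * error_bound q f L T.
Proof.
move=> LN T1 hL; have T0 : 0 < T by exact: lt_le_trans T1.
have A0 := digit_total_ge0 q2 cvgf.
have first0 := @first_term_ge0 R q f T (ltW T0).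
have second0 := @second_term_ge0 R q f L T (ltW T0).
have third0 := third_term_ge0 q2 cvgf L T0.
have firstT := inv_le_first_term q2 cvgf T1.
have pi20 : 0 < pi ^+ 2 :> R by rewrite exprn_gt0// pi_gt0.
rewrite /error_constant /error_bound.
set e := expR (_ * _ * _) in firstT *.
have e0 : 0 < e by exact: expR_gt0.
have e10 : 0 < expR 1 :> R by exact: expR_gt0.
pose a := expR 1 + 4 * A; have a0 : 0 <= a by rewrite /a; lra.
pose b : R := 5 / 2 * pi ^+ 2 * expR 1; have b0 : 0 <= b.
  by rewrite mulr_ge0 ?(ltW e10)// mulr_ge0 ?(ltW pi20).
pose p : R := 2 * pi ^+ 2; have p0 : 0 <= p by rewrite mulr_ge0 ?(ltW pi20).
have pA0 : 0 <= p * A by rewrite mulr_ge0.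
have b' : 0 <= p * (1 + 4 * A) by apply: mulr_ge0 => //; lra.
have q0 : 0 <= 3 * q%:R :> R by rewrite mulr_ge0.
rewrite -/a -/b -/p.
set s1 := first_term _ _ _ in first0 firstT *.
set s2 := second_term _ _ _ _ in second0 *.
set s3 := third_term _ _ _ _ in third0 *.
pose X := (a + 3 * q%:R + p * A) * e.
have X0 : 0 <= X by rewrite mulr_ge0 ?(ltW e0)//; lra.
(* The left-hand side dominates the bound obtained in each of the three cases; the right-hand side
   only adds nonnegative cross terms. *)
have expand : X * s1 + s2 + b * s1 + p * (1 + 4 * A) * s3 <=
    (X + (1 + b + p * (1 + 4 * A))) * (s1 + s2 + s3).
  set c := p * (1 + 4 * A) in b' *.
  have := mulr_ge0 X0 second0; have := mulr_ge0 X0 third0; have := mulr_ge0 b0 second0.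
  have := mulr_ge0 b0 third0; have := mulr_ge0 b' first0; have := mulr_ge0 b' second0.
  rewrite !mulrDl !mulrDr !mul1r; lra.
have [Ta|aT] := ltP T a.
  apply: nearW => K; rewrite !empirical_dfE; apply: le_trans (frequency_dist_le1 _ _ _ _ _) _.
  apply: le_trans expand.
  have : 1 <= a * e * s1.
    rewrite -mulrA (@le_trans _ _ (a / T))//; last by rewrite ler_wpM2l.
    by rewrite ler_pdivlMr// mul1r ltW.
  have := mulr_ge0 b0 first0; have := mulr_ge0 b' third0.
  have := mulr_ge0 (mulr_ge0 q0 (ltW e0)) first0; have := mulr_ge0 (mulr_ge0 pA0 (ltW e0)) first0.
  rewrite /X !mulrDl; lra.
have [s21|s21] := leP 1 s2.
  apply: nearW => K; rewrite !empirical_dfE; apply: le_trans (frequency_dist_le1 _ _ _ _ _) _.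
  apply: le_trans expand.
  have := mulr_ge0 b0 first0; have := mulr_ge0 b' third0; have := mulr_ge0 X0 first0; lra.
have := empirical_df_dist_large y LN aT hL (ltW s21).
apply: filterS => K /le_trans; apply; apply: le_trans expand.
rewrite -/s1 -/s3 -/b -/p.
have h1 : p * A / T <= p * A * e * s1 by rewrite -[leRHS]mulrA ler_wpM2l.
have h2 : 3 * q%:R / T <= 3 * q%:R * e * s1 by rewrite -[leRHS]mulrA ler_wpM2l.
have := mulr_ge0 (mulr_ge0 a0 (ltW e0)) first0.
rewrite /X [p * (_ + _)]mulrDr !mulrDl !mulrA in h1 h2 *; lra.
Qed.

End distance_bound.

(** * Passage to the limiting distribution function *)

Unset Implicit Arguments.

Theorem theorem3 (R : realType) (q : nat) (hq : (2 <= q)%N) :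
  exists C : R -> R,
    forall (f : nat -> R) (F : R -> R),
      q_additive q f ->
      cvgn (series (digit_mean_abs q f)) ->
      infinite_set (digit_pairs q `&` [set p | f (p.1 * q ^ p.2)%N != 0]) ->
      limiting_df f F ->
      forall (N : nat) (T : R),
        (1 <= N)%N -> 1 <= T -> height q T <= (trunc_log q N)%:Z ->
        (sup_norm (fun y => empirical_df f N y - F y)%R <=
         (C (limn (series (digit_mean_abs q f))) *
          error_bound q f (trunc_log q N) T)%R%:E)%E.
Proof.
(* For M the sum of the series, q M is [digit_total], so f enters the constant only through this
   sum. *)
exists (fun M => error_constant q (q%:R * M)).
move=> f F fq cvgf _ limF N T N1 T1 hT.
apply/ge_ereal_sup => _ [y _ <-]; rewrite lee_fin.
have LN := trunc_log_bounds hq N1.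
apply/ler_addgt0Pr => e e0.
(* F is approached along the lengths q^K, for which the uniform bound is known; q^K > K makes this a
   subsequence going to infinity. *)
have closeK : \forall K \near \oo, `|empirical_df f (q ^ K)%N y - F y| <= e.
  have /cvgrPdist_le /(_ e e0) [M _ hM] := limF y.
  near=> K; rewrite distrC; apply: hM; apply: leq_trans (ltnW (ltn_expl K hq)).
  by near: K; exact: nbhs_infty_ge.
near \oo => K.
rewrite -(subrKA (empirical_df f (q ^ K)%N y)).
apply: le_trans (ler_normD _ _) _; apply: lerD; near: K => //.
exact: (empirical_df_dist_le hq fq cvgf y LN T1 hT).
Unshelve. all: by end_near.
Qed.
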